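(* Let $q=2^{2s}$ with $s\ge1$, let $w\in\mathbb{F}_4\subseteq\mathbb{F}_q$ satisfy $w^2=w+1$, and let $f_w(x)=x^{q^4}+wx^{q^3}+wx^q+x\in\mathbb{F}_{q^5}[x]$. Then $f_w$ is a $1$-fat polynomial over $\mathbb{F}_{q^5}$ of index $0$ and maximum weight $3$.
   Context: A $\mathbb{F}_q$-linearized polynomial $f$ over $\mathbb{F}_{q^n}$ (viewed as an $\mathbb{F}_q$-linear map of $\mathbb{F}_{q^n}$) is $r$-fat of index $t$ if there are exactly $r$ elements $m\in\mathbb{F}_{q^n}$ with $\dim_{\mathbb{F}_q}\ker(f(x)-mx^{q^t})>1$; its maximum weight is the maximum of $\dim_{\mathbb{F}_q}\ker(f(x)-mx^{q^t})$ over these $m$. *)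

(* Defs.v *)
From HB Require Import structures.
From mathcomp Require Import all_boot all_order all_algebra all_fingroup.
From mathcomp Require Import all_solvable all_field.

Set Implicit Arguments.
Unset Strict Implicit.
Unset Printing Implicit Defensive.

Import GRing.Theory.
Local Open Scope ring_scope.

Section Linearized.

(* F is the base field F_q, with q = #|F|, and L is the extension F_(q^n), with
   n = \dim {:L}. *)
Variables (F : finFieldType) (L : fieldExtType F).
Implicit Types (f : {poly L}) (m : L) (t r : nat).

Definition linearized f : Prop :=
  forall i, f`_i != 0 -> exists k, i = (#|F| ^ k)%N.

(* linfun is only meaningful on linear functions; linearized_mapE shows that it
   returns x |-> f(x) when f is linearized. *)
Definition linearized_map f : 'End(L) := linfun (fun x : L => f.[x]).

Definition fat_weight f t m : nat :=
  \dim (lker (linearized_map (f - m *: 'X^(#|F| ^ t)))).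

(* finvect_type L is L itself, equipped with its finType structure. *)
Definition fat_points f t : {set finvect_type L} :=
  [set m : finvect_type L | (1 < fat_weight f t m)%N].

Definition fat r t f : Prop := linearized f /\ #|fat_points f t| = r.

(* Equal to 0 when there is no point of weight larger than 1. *)
Definition max_weight t f : nat :=
  (\max_(m in fat_points f t) fat_weight f t m)%N.

Lemma expq_linear k : linear (fun x : L => x ^+ (#|F| ^ k)).
Proof.
move=> a x y /=.
have [p _ pcharFp] := finPcharP F.
have pF : p.-nat (#|F| ^ k)%N.
  by rewrite pnatX -cardsT; apply/orP; left; exact: (pprimeChar_pgroup pcharFp).
rewrite exprDn_pchar; last first.
  by apply: sub_in_pnat pF => i _ /eqP->; rewrite pchar_lalg.
rewrite exprZn; congr (_ *: _ + _).
by elim: k {pF} => [|k IHk]; rewrite ?expr1 // expnS exprM expf_card.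
Qed.

Lemma linearized_horner_linear f :
  linearized f -> linear (fun x : L => f.[x]).
Proof.
move=> lin_f a x y; rewrite !horner_coef scaler_sumr -big_split /=.
apply: eq_bigr => i _; have [->|/lin_f[k ->]] := eqVneq f`_i 0.
  by rewrite !mul0r scaler0 addr0.
by rewrite expq_linear mulrDr scalerAr.
Qed.

Lemma linearized_mapE f :
  linearized f -> linearized_map f =1 (fun x => f.[x]).
Proof.
move=> /linearized_horner_linear lin_f x.
pose g := GRing.isLinear.Build F L L *:%R (fun x : L => f.[x]) lin_f.
pose h : {linear L -> L} := HB.pack (fun x : L => f.[x]) g.
exact: (lfunE h).
Qed.

Lemma linearized_sub_monomial f t m :
  linearized f -> linearized (f - m *: 'X^(#|F| ^ t)).
Proof.
move=> lin_f i; rewrite coefB coefZ coefXn.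
have [-> _|_] := eqVneq i (#|F| ^ t)%N; first by exists t.
by rewrite mulr0 subr0; apply: lin_f.
Qed.

End Linearized.

(* Main.v *)
(* Write z_i = z^(q^i), with i read mod 5. For two independent x, y in the
   kernel of f_w - m X, the coordinates p_ij = x_i y_j - x_j y_i of the plane <x, y>
   satisfy five linear relations, the conjugates of the one obtained by
   eliminating m; these express every p_(i,i+2) through the v_i = p_(i,i+1).
   The Pluecker relations then become five quadrics in v_0, ..., v_4, and in
   characteristic 2 a linear form l in the v_i has its square in the ideal they
   generate; since m v_0 = w l, this gives m = 0.
   For m = 0, write S for the Frobenius map z |-> z^q. As
   S^5 - 1 = (S^2 + w^2 S + 1) (S^3 + w^2 S^2 + w^2 S + 1) and f_w is the second
   factor up to an invertible map commuting with S, degree bounds on the number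
   of roots give dim ker f_w <= 3 and dim im f_w <= 2, hence dim ker f_w = 3. *)

Require Import Defs.
From mathcomp Require Import all_boot all_order all_algebra all_fingroup.
From mathcomp Require Import all_solvable all_field.
From mathcomp Require Import ring zify.

Import GRing.Theory.
Local Open Scope ring_scope.

Section Plucker.
(** [x i], [y i] and [a i] stand for the i-th conjugates of two kernel elements and of 1 - m. *)
Variables (K : idomainType) (w : K) (a x y : nat -> K).
Hypotheses (two0 : 2%:R = 0 :> K) (w2 : w ^+ 2 + w + 1 = 0).
Hypotheses (x5 : forall i, x i.+4.+1 = x i) (y5 : forall i, y i.+4.+1 = y i).
Hypothesis ker_x :
  forall i, a i * x i + w * x i.+1 + w * x i.+3 + x i.+4 = 0.
Hypothesis ker_y :
  forall i, a i * y i + w * y i.+1 + w * y i.+3 + y i.+4 = 0.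

Let v i := x i * y i.+1 - x i.+1 * y i.
Let u i := x i * y i.+2 - x i.+2 * y i.

Let v5 i : v i.+4.+1 = v i.
Proof. by rewrite /v !x5 !y5. Qed.

(** Eliminating [a i.+2] from the two relations at index i+2 leaves w u_i - w v_(i+2) + v_(i+1) = 0,
    and the inverse of w is -(w + 1). *)
Lemma plucker_far i : u i = (w + 1) * v i.+1 + v i.+2.
Proof.
have := ker_x i.+2; have := ker_y i.+2; rewrite !x5 !y5 => hy hx.
apply/subr0_eq.
transitivity (- (w + 1) * (y i.+2 * (a i.+2 * x i.+2 + w * x i.+3 + w * x i
  + x i.+1) - x i.+2 * (a i.+2 * y i.+2 + w * y i.+3 + w * y i + y i.+1))
  + (w ^+ 2 + w + 1) * (u i - v i.+2)); first by rewrite /u /v; ring.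
by rewrite hx hy w2 !mulr0 subr0 mulr0 mul0r addr0.
Qed.

(** Pluecker relation of the indices i, ..., i+3: by periodicity [u i.+3] is -p_(i,i+3), and signs
    disappear in characteristic 2. *)
Lemma plucker_quadric i :
  v i * v i.+2 + u i * u i.+1 + u i.+3 * v i.+1 = 0.
Proof.
transitivity (2%:R * (u i * u i.+1 + u i.+3 * v i.+1)).
  by rewrite /u /v x5 y5; ring.
by rewrite two0 mul0r.
Qed.

(* The square of this linear form lies in the ideal of the quadrics. *)
Lemma plucker_plane :
  v 0%N + (w + 1) * v 1%N + (w + 1) * v 2%N + v 3%N = 0.
Proof.
pose Q v0 v1 v2 v3 v4 : K := v0 * v2
  + ((w + 1) * v1 + v2) * ((w + 1) * v2 + v3) + ((w + 1) * v4 + v0) * v1.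
have Q0 i : Q (v i) (v i.+1) (v i.+2) (v i.+3) (v i.+4) = 0.
  by have := plucker_quadric i; rewrite !plucker_far !v5.
move: (Q0 0%N) (Q0 1%N) (Q0 3%N) (Q0 4%N); rewrite !v5.
move: (v 0%N) (v 1%N) (v 2%N) (v 3%N) (v 4%N) => v0 v1 v2 v3 v4.
move=> E0 E1 E3 E4; apply/eqP; rewrite -sqrf_eq0; apply/eqP.
(* The square is a combination of quadrics modulo [w ^+ 2 + w + 1] and 2; writing out the multiples
   of these two turns it into an identity that [ring] can check. *)
transitivity ((w + 1) * Q v0 v1 v2 v3 v4 - w * Q v1 v2 v3 v4 v0
    + w * Q v3 v4 v0 v1 v2 + (w + 1) * Q v4 v0 v1 v2 v3
  + (w ^+ 2 + w + 1) * (- v0 ^+ 2 - 2%:R * v0 * v1 - w * v0 * v1 - v0 * v3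
    - v0 * v4 - w * v0 * v4 - w * v1 * v2 - v1 * v3 - 2%:R * v1 * v4
    + v2 * v3 + w * v2 * v3 + v3 ^+ 2)
  + 2%:R * (v0 ^+ 2 + v0 * v1 + v0 * v3 - w * v0 * v3 + w * v1 * v2 + v1 * v3
    + w * v1 * v3 - w * v1 * v4)); first by rewrite /Q; ring.
by rewrite E0 E1 E3 E4 w2 two0 !mulr0 !mul0r subr0 !addr0.
Qed.

Lemma plucker_eigenvalue : v 0%N != 0 -> a 0%N = 1.
Proof.
move=> v_neq0; apply/subr0_eq/(mulIf v_neq0); rewrite mul0r.
(* Eliminating the w x_1 and w y_1 terms keeps [a 0]; then (a_0 - 1) v_0 is w times the form of
   [plucker_plane]. *)
have av : a 0%N * v 0%N = w * u 1%N - u 4%N.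
  apply/subr0_eq; rewrite /u (x5 1%N) (y5 1%N).
  transitivity (y 1%N * (a 0%N * x 0%N + w * x 1%N + w * x 3%N + x 4%N)
    - x 1%N * (a 0%N * y 0%N + w * y 1%N + w * y 3%N + y 4%N)).
    by rewrite /v; ring.
  by rewrite ker_x ker_y !mulr0 subr0.
rewrite mulrBl av !plucker_far (v5 0%N) (v5 1%N).
transitivity (w * (v 0%N + (w + 1) * v 1%N + (w + 1) * v 2%N + v 3%N)
  - 2%:R * (w + 1) * v 0%N - (w ^+ 2 + w + 1) * v 1%N); first by ring.
by rewrite plucker_plane w2 two0 mulr0 !mul0r !subr0.
Qed.

End Plucker.

Section Kernels.
Variables (F : finFieldType) (L : fieldExtType F).
Implicit Types (V : {vspace L}) (r : {poly L}) (x y z : L).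

(** V has q^(dim V) elements, all roots of one polynomial, which the bound on [r] makes monic of
    degree q^k. *)
Lemma dim_roots_le V k r :
    (size r <= #|F| ^ k)%N ->
    {in V, forall z, z ^+ (#|F| ^ k) + r.[z] = 0} ->
  (\dim V <= k)%N.
Proof.
move=> size_r V0; pose p := 'X^(#|F| ^ k) + r.
have size_p : size p = (#|F| ^ k).+1 by rewrite size_polyDl size_polyXn.
have p_neq0 : p != 0 by rewrite -size_poly_eq0 size_p.
pose W : {vspace finvect_type L} := V.
rewrite -(leq_exp2l _ _ (finNzRing_gt1 F)) -(card_vspace W) cardE -ltnS -size_p.
apply: (max_poly_roots p_neq0); last exact: enum_uniq.
apply/allP => z; rewrite (mem_enum W) => /V0 z0.
by rewrite rootE hornerD hornerXn z0.
Qed.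

Lemma expq_fixed z : z ^+ #|F| = z -> exists c : F, z = c%:A.
Proof.
move=> zq; apply/vlineP; have := Fermat's_little_theorem 1%AS z.
by rewrite dimv1 expn1 zq eqxx.
Qed.

(** If the difference vanishes, y / x is fixed by z |-> z^q, so it lies in F. This yields v_0 != 0
    for independent x, y. *)
Lemma expq_wedge_neq0 x y :
  x != 0 -> y \notin <[x]>%VS -> x * y ^+ #|F| - x ^+ #|F| * y != 0.
Proof.
move=> x_neq0; apply: contra; rewrite subr_eq0 => /eqP xy.
have xq_neq0 : x ^+ #|F| != 0 by rewrite expf_neq0.
have [|c yx] := @expq_fixed (y / x).
  rewrite expr_div_n; apply/eqP; rewrite eqr_div //; apply/eqP.
  by rewrite mulrC xy mulrC.
by apply/vlineP; exists c; rewrite -mulr_algl -yx divfK.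
Qed.

Lemma expq_iter_dim i z : z ^+ (#|F| ^ (i + \dim {:L})) = z ^+ (#|F| ^ i).
Proof.
rewrite expnD exprM; apply/eqP.
by rewrite -(Fermat's_little_theorem {:L}%AS) memvf.
Qed.

Lemma expq_scale k (c : F) z :
  (c%:A * z) ^+ (#|F| ^ k) = c%:A * z ^+ (#|F| ^ k).
Proof.
have := expq_linear k c z 0; rewrite /= addr0 expr0n expn_eq0.
by rewrite eqn0Ngt (ltnW (finNzRing_gt1 F)) addr0 !mulr_algl.
Qed.

End Kernels.

Theorem theorem6p1 (s q : nat) (F : finFieldType) (L : fieldExtType F) (w : F)
    (s_ge1 : (1 <= s)%N) (qE : q = (2 ^ (2 * s))%N) (cardF : #|F| = q)
    (dimL : \dim {:L} = 5%N)
    (w_in_F4 : w ^+ 4 = w) (w2 : w ^+ 2 = w + 1) :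
  let f_w : {poly L} :=
    'X^(q ^ 4) + w%:A *: 'X^(q ^ 3) + w%:A *: 'X^q + 'X in
  fat 1 0 f_w /\ max_weight 0 f_w = 3%N.
Proof.
set W : L := w%:A; move=> f_w.
have pchar2 : 2%N \in [pchar F].
  by apply: (@card_finPcharP _ _ (2 * s)); rewrite // cardF qE.
have two0 : 2%:R = 0 :> L by apply/pcharf0; rewrite pchar_lalg.
have W2 : W ^+ 2 + W + 1 = 0.
  rewrite /W -in_algE -rmorphXn w2 rmorphD rmorph1 /=.
  transitivity (2%:R * (in_alg L w + 1)); first by rewrite /=; ring.
  by rewrite two0 mul0r.
have q_gt1 : (1 < q)%N by rewrite -cardF finNzRing_gt1.
have lin_f : linearized f_w.
  move=> i; rewrite !coefD !coefZ !coefXn coefX cardF.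
  have [->|_] := eqVneq i (q ^ 4)%N; first by exists 4%N.
  have [->|_] := eqVneq i (q ^ 3)%N; first by exists 3%N.
  have [->|_] := eqVneq i q; first by exists 1%N.
  have [->|_] := eqVneq i 1%N; first by exists 0%N.
  by rewrite !mulr0 !addr0 eqxx.
pose fr i (z : L) := z ^+ (q ^ i).
have frE i z : z ^+ (q ^ i) = fr i z by [].
have fr5 i z : fr i.+4.+1 z = fr i z.
  by rewrite /fr -cardF -[RHS]expq_iter_dim dimL !addnS addn0.
have frS i j z : fr i (fr j z) = fr (i + j)%N z.
  by rewrite /fr -exprM -expnD addnC.
have frD i y z : fr i (y + z) = fr i y + fr i z.
  by have := @expq_linear F L i 1 y z; rewrite /fr -cardF !scale1r.
have fr0 z : fr 0%N z = z by rewrite /fr expr1.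
have fr_0 i : fr i 0 = 0 by rewrite /fr expr0n expn_eq0 -leqn0 leqNgt ltnW.
have frM i y z : fr i (y * z) = fr i y * fr i z by rewrite /fr exprMn.
have frW i z : fr i (W * z) = W * fr i z.
  by rewrite /fr -cardF expq_scale.
have f_wE z : f_w.[z] = fr 4%N z + W * fr 3%N z + W * fr 1%N z + fr 0%N z.
  by rewrite !hornerE /fr expr1 expn1.
have kerE m z : (z \in lker (linearized_map (f_w - m *: 'X^(#|F| ^ 0)))) =
    ((1 - m) * fr 0%N z + W * fr 1%N z + W * fr 3%N z + fr 4%N z == 0).
  rewrite memv_ker linearized_mapE; last exact: linearized_sub_monomial.
  congr (_ == 0); rewrite hornerD hornerN hornerZ hornerXn expr1 f_wE fr0.
  by ring.
have fat_eq0 m : (1 < fat_weight f_w 0 m)%N -> m = 0.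
  rewrite /fat_weight; set V := lker _ => dimV.
  have V_neq0 : V != 0%VS by rewrite -dimv_eq0 -lt0n ltnW.
  have x_neq0 : vpick V != 0 by rewrite vpick0.
  have /subvPn[y Vy xy] : ~~ (V <= <[vpick V]>)%VS.
    by apply: contraL dimV => /dimvS; rewrite dim_vline x_neq0 -leqNgt.
  move: (memv_pick V) Vy; move: (vpick V) x_neq0 xy => x x_neq0 xy.
  rewrite !kerE => /eqP ker_x /eqP ker_y.
  (* Applying [fr i] conjugates the kernel equation; with c = 1 - m this supplies the relations at
     every index. *)
  have shift c z : c * fr 0%N z + W * fr 1%N z + W * fr 3%N z + fr 4%N z = 0
      -> forall i,
      fr i c * fr i z + W * fr i.+1 z + W * fr i.+3 z + fr i.+4 z = 0.
    move=> /(congr1 (fr _)) z0 i; have := z0 i; rewrite fr_0 !frD !frW frM !frS.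
    by rewrite !addn0 addn1 addn3 addn4.
  have := plucker_eigenvalue L W _ _ _ two0 W2
    (fr5^~ x) (fr5^~ y) (shift _ x ker_x) (shift _ y ker_y).
  rewrite !fr0 => m1; apply/oppr_inj/(addrI 1); rewrite m1 ?oppr0 ?addr0 //.
  by rewrite /fr expn1 -cardF expq_wedge_neq0.
have weight0 : fat_weight f_w 0 0 = 3%N.
  have size_D (r1 r2 : {poly L}) k :
      (size r1 <= k -> size r2 <= k -> size (r1 + r2)%R <= k)%N.
    move=> r1k r2k; rewrite (leq_trans (size_polyD _ _)) //.
    by rewrite geq_max r1k r2k.
  have size_Xq i k : (i < k)%N -> (size ('X^(q ^ i) : {poly L}) <= q ^ k)%N.
    by move=> ik; rewrite size_polyXn ltn_exp2l.
  have size_cXq c i k :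
      (i < k)%N -> (size (c *: 'X^(q ^ i) : {poly L}) <= q ^ k)%N.
    by move=> /size_Xq; apply/leq_trans/size_scale_leq.
  rewrite /fat_weight; set V := lker _.
  apply/eqP; rewrite eqn_leq; apply/andP; split.
    (* Modulo S^5 = 1, S^2 f_w is w S^3 + S^2 + S + w; dividing by w, whose inverse is w + 1, gives
       the cubic factor, and [r] is its lower part. *)
    pose r : {poly L} :=
      (W + 1) *: 'X^(q ^ 2) + (W + 1) *: 'X^(q ^ 1) + 'X^(q ^ 0).
    apply: (dim_roots_le F L V 3 r); rewrite cardF.
      by rewrite !size_D ?size_cXq ?size_Xq.
    move=> z; rewrite kerE subr0 mul1r => /eqP/(congr1 (fr 2)).
    rewrite fr_0 !frD !frW !frS /= !fr5 => z2.
    rewrite !(hornerD, hornerZ, hornerXn) !frE.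
    transitivity ((W + 1) * (fr 2 z + W * fr 3 z + W * fr 0%N z + fr 1%N z)
      - (W ^+ 2 + W + 1) * (fr 3 z + fr 0%N z) + 2%:R * (fr 3 z + fr 0%N z)).
      by ring.
    by rewrite z2 W2 two0 mulr0 !mul0r subr0 addr0.
  set f0 := linearized_map _ in V *.
  have := limg_ker_dim f0 fullv; rewrite capfv dimL -/V => dim_ker_img.
  suff : (\dim (limg f0) <= 2)%N by lia.
  (* Lower part of the cofactor S^2 + w^2 S + 1, where w^2 = w + 1; its composite with f_w vanishes
     by S^5 = 1, so it kills the image. *)
  pose r : {poly L} := (W + 1) *: 'X^(q ^ 1) + 'X^(q ^ 0).
  apply: (dim_roots_le F L _ 2 r); rewrite cardF.
    by rewrite size_D ?size_cXq ?size_Xq.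
  move=> _ /memv_imgP[z _ ->].
  rewrite /f0 linearized_mapE; last exact: linearized_sub_monomial.
  rewrite scale0r subr0 f_wE !(hornerD, hornerZ, hornerXn) !frE.
  rewrite !frD !frW !frS /= !fr5.
  transitivity ((W ^+ 2 + W + 1) * (fr 2 z + fr 4 z)
    + 2%:R * ((W + 1) * (fr 0%N z + fr 1%N z) + W * fr 3 z)); first by ring.
  by rewrite W2 two0 !mul0r addr0.
have fat1 : fat_points f_w 0 = [set 0 : finvect_type L].
  apply/setP => m; rewrite !inE; apply/idP/eqP => [/fat_eq0 // | ->].
  by rewrite weight0.
split; first by split; rewrite // fat1 cards1.
by rewrite /max_weight fat1 big_set1 weight0.
Qed.
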